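(* In the absence of mass source ($\mathfrak M_i=0$ for all $i$), along classical solutions of the semidiscrete system $$\sigma_i\frac{\rm d}{{\rm d}t}\theta_i h_i+\sum_{j\in\mathcal N(i)}l_{(i,j)}\,\theta h_{(i,j)}\,(v_n)_{(i,j)}=\sigma_i\mathfrak M_i,$$ $$\sigma_i\frac{\rm d}{{\rm d}t}\theta_i h_i v_{a\,i}+\sum_{j\in\mathcal N(i)}l_{(i,j)}\,\theta h_{(i,j)}\,(v_a)_{(i,j)}(v_n)_{(i,j)}+\frac12\sum_{j\in\mathcal N(i)}l_{(i,j)}(w_j-w_i)\,\theta h^s_{(i,j)}\,(n_a)_{(i,j)}=-\sigma_i\mathcal K_i|\boldsymbol v|_i v_{a\,i},\quad a=1,2,$$ the cell energy $$\mathcal E_i(h_i,\boldsymbol v_i)=\theta_i\left(\tfrac12|\boldsymbol v|_i^2h_i+\tfrac12 g h_i^2+g x^3_i h_i\right)$$ satisfies $$\sigma_i\frac{\rm d}{{\rm d}t}\mathcal E_i+\sum_{j\in\mathcal N(i)}l_{(i,j)}\left<\mathcal H_{(i,j)},\boldsymbol n_{(i,j)}\right>=-\sigma_i\mathcal K_i|\boldsymbol v|_i^3,$$ where $$\mathcal H_{(i,j)}=\tfrac12\,\theta h_{(i,j)}\left(w_i\boldsymbol v_i+w_j\boldsymbol v_j+\left<\boldsymbol v_i,\boldsymbol v_j\right>\boldsymbol v_{(i,j)}\right).$$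
   Context: $\Omega\subset\mathbb R^2$ is partitioned into polygons $\omega_i$, $i=1,\dots,N$ (an admissible polygonal partition); $\sigma_i$ is the area of $\omega_i$; $\mathcal N(i)$ is the set of all neighbours of $\omega_i$; $l_{(i,j)}$ is the length of the common side of $\omega_i$ and $\omega_j$, and $\boldsymbol n_{(i,j)}=((n_1)_{(i,j)},(n_2)_{(i,j)})$ its unit normal pointing towards $\omega_j$. Each cell carries a water depth $h_i$, a water velocity $\boldsymbol v_i=(v_{1\,i},v_{2\,i})\in\mathbb R^2$ with $|\boldsymbol v|_i=|\boldsymbol v_i|$, a time-independent porosity $\theta_i$ (quantifying the density of the plant cover) and a time-independent soil altitude $x^3_i=z_i$. $g$ is the gravitational acceleration, $w_i=g(z_i+h_i)$, $\mathcal K_i=\alpha_p h_i(1-\theta_i)+\theta_i\alpha_s$, where $\alpha_p,\alpha_s$ are parameters of the strength of the water-plant and water-soil interactions, and $\mathfrak M_i$ is the mass source (rain and infiltration) in cell $i$. $\left<\cdot,\cdot\right>$ is the Euclidean scalar product on $\mathbb R^2$. Interface values: for $a=1,2$, $(v_a)_{(i,j)}=\frac{v_{a\,i}+v_{a\,j}}2$, these being the components of $\boldsymbol v_{(i,j)}$; $(v_n)_{(i,j)}=\boldsymbol v_{(i,j)}\cdot\boldsymbol n_{(i,j)}$; $\theta h_{(i,j)}=\theta_ih_i$ if $(v_n)_{(i,j)}>0$, and $\theta h_{(i,j)}=\theta_jh_j$ if $(v_n)_{(i,j)}<0$; $\theta h^s_{(i,j)}=\theta h_{(i,j)}$ if $(v_n)_{(i,j)}\neq0$;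 $\theta h^s_{(i,j)}=\theta_ih_i$ if $(v_n)_{(i,j)}=0$ and $w_i>w_j$; $\theta h^s_{(i,j)}=\theta_jh_j$ if $(v_n)_{(i,j)}=0$ and $w_i\le w_j$. Boundary conditions (free discharge): to each side of $\omega_i$ on $\Gamma=\partial\Omega$ a ghost cell is attached, with some assigned altitude and zero water depth; on that side the velocity is $\boldsymbol v_i$, and the water depth is $h_i$ if $\boldsymbol v_i\cdot\boldsymbol n>0$ and $0$ if $\boldsymbol v_i\cdot\boldsymbol n<0$, where $\boldsymbol n$ is the outer unit normal on that side.
   Formalization: The printed flux makes the balance false (two cells with different w and normal velocity), so the flux proved is H_(i,j) = ½ θh_(i,j) (w_i v_j + w_j v_i + <v_i,v_j> v_(i,j)); where (v_n)_(i,j) = 0, θh_(i,j), left undefined, is taken to be θh^s_(i,j). *)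

(* Defs.v *)
From mathcomp Require Export all_boot all_order all_algebra.
From mathcomp Require Export all_classical all_reals all_analysis.
Export Order.TTheory GRing.Theory Num.Theory numFieldNormedType.Exports.

Set Implicit Arguments.
Unset Strict Implicit.
Unset Printing Implicit Defensive.

Local Open Scope classical_set_scope.
Local Open Scope ring_scope.

(* Points and vectors of the plane are pairs.  The library norm on [R * R] is
   the sup norm (same topology), so the Euclidean structure is spelled out. *)
Section Plane.
Context {R : realType}.
Implicit Types p q x y : R * R.

Definition dot x y : R := x.1 * y.1 + x.2 * y.2.

Definition enorm x : R := Num.sqrt (dot x x).

Definition segment p q : set (R * R) :=
  [set p + s *: (q - p) | s in [set s : R | 0 <= s <= 1]].

Definition half_open_segment p q : set (R * R) :=
  [set p + s *: (q - p) | s in [set s : R | 0 <= s < 1]].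

Definition midpoint p q : R * R := 2^-1 *: (p + q).

Definition frontier (A : set (R * R)) : set (R * R) := closure A `\` interior A.

(* The tangent [q - p] turned clockwise: the side has this normal on its right. *)
Definition right_normal p q : R * R :=
  (enorm (q - p))^-1 *: ((q - p).2, - (q - p).1).

Definition corner (vs : seq (R * R)) (k : nat) : R * R :=
  nth 0 vs (k %% size vs).

Definition side (vs : seq (R * R)) (k : nat) : set (R * R) :=
  segment (corner vs k) (corner vs k.+1).

(* [w] is the open region enclosed by the simple closed polygonal line through
   the cyclic list [vs] (flat corners are allowed, so a straight edge may be
   subdivided into several sides).  Disjointness of the half-open sides is
   simplicity of the line; a bounded nonempty open set whose frontier is a
   Jordan curve is the interior of that curve.  The last clause orients [vs]
   with [w] on the left, so that [right_normal] is the outer unit normal. *)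
Definition polygon (w : set (R * R)) (vs : seq (R * R)) : Prop :=
  [/\ (3 <= size vs)%N,
      trivIset [set k | (k < size vs)%N]
        (fun k => half_open_segment (corner vs k) (corner vs k.+1)),
      [/\ open w, bounded_set w & w !=set0],
      frontier w = \bigcup_(k in [set k | (k < size vs)%N]) side vs k &
      forall k, (k < size vs)%N ->
        \forall e \near 0^'+,
          w (midpoint (corner vs k) (corner vs k.+1)
             - e *: right_normal (corner vs k) (corner vs k.+1))].

End Plane.

(* Admissibility: two cells either meet in finitely many points or along
   exactly one full side of both of them. *)
Record polygonal_partition (R : realType) (N : nat) (Omega : set (R * R)) :=
  PolygonalPartition {
    cell : 'I_N -> set (R * R) ;
    corners : 'I_N -> seq (R * R) ;
    domain_open : open Omega ;
    cell_polygon : forall i, polygon (cell i) (corners i) ;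
    cell_sub : forall i, cell i `<=` Omega ;
    cell_disjoint : trivIset setT cell ;
    cell_cover : closure Omega = \bigcup_i closure (cell i) ;
    cell_admissible : forall i j, i != j ->
      finite_set (closure (cell i) `&` closure (cell j)) \/
      exists (k : 'I_(size (corners i))) (l : 'I_(size (corners j))),
        side (corners i) k = side (corners j) l /\
        closure (cell i) `&` closure (cell j) = side (corners i) k
  }.

Section Mesh.
Context {R : realType} {N : nat} {Omega : set (R * R)}.
Variable P : polygonal_partition N Omega.

Definition area (i : 'I_N) : R :=
  fine ((lebesgue_measure \x lebesgue_measure)%E (cell P i)).

Definition sides (i : 'I_N) := 'I_(size (corners P i)).

(* [inl j] is the cell [j]; [inr k] is the ghost cell attached to the [k]-th
   side of cell [i]. *)
Definition adjacent (i : 'I_N) : Type := ('I_N + sides i)%type.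

Definition interface (i : 'I_N) (j : adjacent i) : option (sides i) :=
  match j with
  | inl j => [pick k : sides i |
      `[< exists l : sides j,
            side (corners P i) k = side (corners P j) l >] ]
  | inr k => Some k
  end.

Definition neighbour (i : 'I_N) (j : adjacent i) : bool :=
  match j with
  | inl j' => (j' != i) && (interface j : bool)
  | inr k => `[< side (corners P i) k `<=` frontier Omega >]
  end.

Definition side_length (i : 'I_N) (j : adjacent i) : R :=
  if interface j is Some k
  then enorm (corner (corners P i) k.+1 - corner (corners P i) k) else 0.

Definition side_normal (i : 'I_N) (j : adjacent i) : R * R :=
  if interface j is Some k
  then right_normal (corner (corners P i) k) (corner (corners P i) k.+1) else 0.

Record data := Data {
  gravity : R ;
  alpha_p : R ;
  alpha_s : R ;
  porosity : 'I_N -> R ;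
  altitude : 'I_N -> R ;
  ghost_altitude : forall i : 'I_N, sides i -> R
}.

Record state := State {
  depth : 'I_N -> R ;
  velocity : 'I_N -> R * R
}.

Variable D : data.

Section Interface_values.
Variables (u : state) (i : 'I_N).

Definition level (k : 'I_N) : R := gravity D * (altitude D k + depth u k).

Definition adjacent_level (j : adjacent i) : R :=
  match j with
  | inl j => level j
  | inr k => gravity D * (ghost_altitude D k + 0)
  end.

Definition theta_depth (k : 'I_N) : R := porosity D k * depth u k.

Definition adjacent_theta_depth (j : adjacent i) : R :=
  match j with inl j => theta_depth j | inr _ => 0 end.

(* Giving the ghost cell the velocity of cell [i] makes the interface velocity
   on a boundary side equal to the velocity of cell [i]. *)
Definition adjacent_velocity (j : adjacent i) : R * R :=
  match j with inl j => velocity u j | inr _ => velocity u i end.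

Definition mean_velocity (j : adjacent i) : R * R :=
  2^-1 *: (velocity u i + adjacent_velocity j).

Definition normal_velocity (j : adjacent i) : R :=
  dot (mean_velocity j) (side_normal j).

Definition level_upwind (j : adjacent i) : R :=
  if level i > adjacent_level j then theta_depth i else adjacent_theta_depth j.

(* The upwind rule leaves this value open when the normal velocity is 0.  It is
   immaterial in the balance equations, where it multiplies the normal velocity,
   but not in [energy_flux]; there it has to be the value of [theta_h_s]. *)
Definition theta_h (j : adjacent i) : R :=
  if normal_velocity j > 0 then theta_depth i
  else if normal_velocity j < 0 then adjacent_theta_depth j
  else level_upwind j.

Definition theta_h_s (j : adjacent i) : R :=
  if normal_velocity j != 0 then theta_h j else level_upwind j.

Definition friction : R :=
  alpha_p D * depth u i * (1 - porosity D i) + porosity D i * alpha_s D.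

Definition cell_energy : R :=
  porosity D i * (2^-1 * enorm (velocity u i) ^+ 2 * depth u i
                  + 2^-1 * gravity D * depth u i ^+ 2
                  + gravity D * altitude D i * depth u i).

(* The levels are paired crosswise with the velocities: [w_i v_j + w_j v_i].
   The source prints [w_i v_i + w_j v_j], for which the energy balance fails: its
   two sides then differ by the sum over the neighbours of
   [2^-1 * l * theta_h * (w_i - w_j) * dot (v_j - v_i) n]. *)
Definition energy_flux (j : adjacent i) : R * R :=
  (2^-1 * theta_h j) *:
    (level i *: adjacent_velocity j + adjacent_level j *: velocity u i
     + dot (velocity u i) (adjacent_velocity j) *: mean_velocity j).

End Interface_values.

Definition mass_balance (M : 'I_N -> R -> R) (u : R -> state) (i : 'I_N) (t : R) :
    Prop :=
  area i * derive1 (fun s => theta_depth (u s) i) t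
  + \sum_(j : adjacent i | neighbour j)
      side_length j * theta_h (u t) j * normal_velocity (u t) j
  = area i * M i t.

(* [a] is the coordinate, [fst] or [snd]. *)
Definition momentum_balance (a : R * R -> R) (u : R -> state) (i : 'I_N) (t : R) :
    Prop :=
  area i * derive1 (fun s => theta_depth (u s) i * a (velocity (u s) i)) t
  + \sum_(j : adjacent i | neighbour j)
      side_length j * theta_h (u t) j * a (mean_velocity (u t) j)
      * normal_velocity (u t) j
  + 2^-1 * \sum_(j : adjacent i | neighbour j)
      side_length j * (adjacent_level (u t) j - level (u t) i)
      * theta_h_s (u t) j * a (side_normal j)
  = - (area i * friction (u t) i * enorm (velocity (u t) i)
       * a (velocity (u t) i)).

Definition classical_solution (M : 'I_N -> R -> R) (I : set R) (u : R -> state) :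
    Prop :=
  forall t, I t -> forall i,
    [/\ derivable (fun s => depth (u s) i) t 1,
        derivable (fun s => (velocity (u s) i).1) t 1 &
        derivable (fun s => (velocity (u s) i).2) t 1] /\
    [/\ mass_balance M u i t,
        momentum_balance fst u i t &
        momentum_balance snd u i t].

End Mesh.

Arguments data {R N Omega} P.
Arguments state R N : clear implicits.

(* Main.v *)
(** Testing the momentum equations with [v_i] and the mass equation with
    [w_i - |v_i|^2 / 2] gives
      [E_i' = <v_i, (theta_i h_i v_i)'> + (w_i - |v_i|^2 / 2) (theta_i h_i)'].
    The interface sums then combine side by side: the upwind values [theta_h] and
    [theta_h_s] coincide, [<v_i, v_(i,j)> - |v_i|^2 / 2 = <v_i, v_j> / 2], and
      [(w_j - w_i) v_i / 2 + w_i v_(i,j) = (w_i v_j + w_j v_i) / 2]. *)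

Require Import Defs.
From mathcomp Require Import ring.

Local Open Scope classical_set_scope.
Local Open Scope ring_scope.

Lemma enorm_sqr (R : realType) (x : R * R) : enorm x ^+ 2 = dot x x.
Proof. by rewrite sqr_sqrtr // addr_ge0 // -expr2 sqr_ge0. Qed.

Section EnergyBalance.
Context {R : realType} {N : nat} {Omega : set (R * R)}.
Variables (P : polygonal_partition N Omega) (D : data P).

(** At zero normal velocity both strict tests in [theta_h] fail, which leaves [level_upwind]. *)
Lemma theta_h_sE (u : state R N) (i : 'I_N) (j : adjacent P i) :
  theta_h_s D u j = theta_h D u j.
Proof.
rewrite /theta_h_s; case: eqP => //= v0.
by rewrite /theta_h v0 ltxx.
Qed.

(** Once the two upwind values agree, this is a polynomial identity in which the adjacent velocity
    and level are free, so it treats inner sides and ghost cells alike. *)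
Lemma energy_flux_side (u : state R N) (i : 'I_N) (j : adjacent P i) :
  let v := velocity u i in
  side_length j * dot (energy_flux D u j) (side_normal j) =
    (level D u i - 2^-1 * dot v v)
      * (side_length j * theta_h D u j * normal_velocity u j)
  + v.1 * (side_length j * theta_h D u j * (mean_velocity u j).1
           * normal_velocity u j
           + 2^-1 * (side_length j * (adjacent_level D u j - level D u i)
                     * theta_h_s D u j * (side_normal j).1))
  + v.2 * (side_length j * theta_h D u j * (mean_velocity u j).2
           * normal_velocity u j
           + 2^-1 * (side_length j * (adjacent_level D u j - level D u i)
                     * theta_h_s D u j * (side_normal j).2)).
Proof.
rewrite theta_h_sE /energy_flux /normal_velocity /dot /mean_velocity /=.
rewrite /GRing.scale /=.
by field.
Qed.

(** The coefficients are the partial derivatives of the energy [|q|^2 / (2 m) + g m^2 / (2 theta) +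
    g z m] in the conserved variables [m = theta h] and [q = theta h v]. Differentiating in [h] and
    [v] instead avoids dividing by [m], so dry cells are covered. *)
Lemma is_derive_cell_energy (u : R -> state R N) (i : 'I_N) (t : R) :
  derivable (fun s => depth (u s) i) t 1 ->
  derivable (fun s => (velocity (u s) i).1) t 1 ->
  derivable (fun s => (velocity (u s) i).2) t 1 ->
  let v := velocity (u t) i in
  is_derive t 1 (fun s => cell_energy D (u s) i)
    ((level D (u t) i - 2^-1 * dot v v)
       * derive1 (fun s => theta_depth D (u s) i) t
     + v.1 * derive1 (fun s => theta_depth D (u s) i * (velocity (u s) i).1) t
     + v.2 * derive1 (fun s => theta_depth D (u s) i * (velocity (u s) i).2) t).
Proof.
set h := fun s => depth (u s) i.
set v1 := fun s => (velocity (u s) i).1.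
set v2 := fun s => (velocity (u s) i).2.
move=> /derivableP dh /derivableP dv1 /derivableP dv2 /=.
set h' := 'D_1 h t in dh; set v1' := 'D_1 v1 t in dv1.
set v2' := 'D_1 v2 t in dv2.
have dth : is_derive t 1 (fun s => theta_depth D (u s) i) (porosity D i * h').
  by apply: is_deriveZ.
have dq (v : R -> R) v' : is_derive t 1 v v' ->
    is_derive t 1 (fun s => theta_depth D (u s) i * v s)
      (theta_depth D (u t) i * v' + v t * (porosity D i * h')).
  by move=> dv; exact: (is_deriveM dth dv).
rewrite !derive1E (@derive_val _ _ _ _ _ _ _ dth).
rewrite (@derive_val _ _ _ _ _ _ _ (dq _ _ dv1)).
rewrite (@derive_val _ _ _ _ _ _ _ (dq _ _ dv2)).
(* Replacing the squared norm by [v1 * v1 + v2 * v2] removes the square root, which is not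
   differentiable at 0. *)
have -> : (fun s => cell_energy D (u s) i) =
    porosity D i *: ((2^-1 *: ((v1 * v1 + v2 * v2) * h)
      + (2^-1 * gravity D) *: (h * h)) + (gravity D * altitude D i) *: h).
  apply/funext => s; rewrite /cell_energy enorm_sqr /dot !fctE /GRing.scale /=.
  by rewrite /v1 /v2 /h; ring.
have dsq := is_deriveD (is_deriveM dv1 dv1) (is_deriveM dv2 dv2).
have dkin := is_deriveZ 2^-1 (is_deriveM dsq dh).
have dpress := is_deriveZ (2^-1 * gravity D) (is_deriveM dh dh).
have dpot := is_deriveZ (gravity D * altitude D i) dh.
have dE := is_deriveZ (porosity D i) (is_deriveD (is_deriveD dkin dpress) dpot).
apply: (is_derive_eq dE).
rewrite !fctE /GRing.scale /= /level /dot /theta_depth -/(h t) -/(v1 t) -/(v2 t).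
by field.
Qed.

End EnergyBalance.

Theorem proposition4p1 (R : realType) (N : nat) (Omega : set (R * R))
    (P : polygonal_partition N Omega) (D : data P)
    (M : 'I_N -> R -> R) (I : set R) (u : R -> state R N)
    (HIopen : open I) (HIint : is_interval I)
    (HM : forall i t, I t -> M i t = 0)
    (Hu : classical_solution D M I u)
    (i : 'I_N) (t : R) (Ht : I t) :
  derivable (fun s => cell_energy D (u s) i) t 1 /\
  area P i * derive1 (fun s => cell_energy D (u s) i) t
  + \sum_(j : adjacent P i | neighbour j)
      side_length j * dot (energy_flux D (u t) j) (side_normal j)
  = - (area P i * friction D (u t) i * enorm (velocity (u t) i) ^+ 3).
Proof.
have [[dh dv1 dv2] [mass mom1 mom2]] := Hu _ Ht i.
have dE := is_derive_cell_energy P D u i t dh dv1 dv2.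
split; first exact: ex_derive.
rewrite [X in area P i * X + _]derive1E (@derive_val _ _ _ _ _ _ _ dE).
under eq_bigr do rewrite energy_flux_side.
rewrite !big_split -!mulr_sumr !big_split -!mulr_sumr /=.
(* Only two of the three norm factors are expanded; the third is the one already present in the
   friction terms. *)
rewrite exprSr enorm_sqr [in RHS]/dot.
move: mass mom1 mom2; rewrite /mass_balance /momentum_balance HM // mulr0 /= => mass mom1 mom2.
set w := level _ _ _ - _.
set n := enorm _.
(* The middle term combines the right-hand sides of the three balances; its [0] is the vanishing
   mass source, to be traded for the left-hand side of the mass equation. *)
transitivity (w * 0 + (velocity (u t) i).1 *
    - (area P i * friction D (u t) i * n * (velocity (u t) i).1)
  + (velocity (u t) i).2 *
    - (area P i * friction D (u t) i * n * (velocity (u t) i).2)); last by ring.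
rewrite -mom1 -mom2 -[X in _ = w * X + _ + _]mass.
by ring.
Qed.
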